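(* Trees have unbounded anagram-free chromatic number; that is, for every positive integer $c$ there exists a tree $T$ such that $\phi(T) > c$.
   Context: Graphs are finite, simple and undirected. An anagram is a word of the form $W_1W_2$ where $W_1$ is a non-empty word and $W_2$ is a permutation of $W_1$ (i.e. each symbol occurs equally often in $W_1$ and $W_2$). A vertex colouring of a graph $G$ is a function $f:V(G)\to C$ where $C$ is a set of colours (no properness is assumed). A vertex colouring of $G$ is anagram-free if for every path $v_1,\dots,v_n$ that is a subgraph of $G$, the sequence of colours $f(v_1)\cdots f(v_n)$ is not an anagram. The anagram-free chromatic number $\phi(G)$ is the minimum number of colours in an anagram-free vertex colouring of $G$. *)

(* Defs.v *)
From mathcomp Require Import all_boot boolp.

Set Implicit Arguments.
Unset Strict Implicit.
Unset Printing Implicit Defensive.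

Record sgraph := SGraph {
  vertex :> finType;
  adj : rel vertex;
  adj_sym : symmetric adj;
  adj_irr : irreflexive adj }.

(* A path that is a subgraph of G, given by its sequence of vertices: the
   vertices are pairwise distinct and consecutive ones are adjacent. *)
Definition is_path (G : sgraph) (p : seq G) : bool :=
  uniq p && sorted (@adj G) p.

Definition connected (G : sgraph) : Prop :=
  forall x y : G, connect (@adj G) x y.

(* The bound on the size is needed: [ucycle] also holds of the empty sequence
   and of the two ends of an edge. *)
Definition acyclic (G : sgraph) : Prop :=
  forall p : seq G, 2 < size p -> ~ ucycle (@adj G) p.

Definition is_tree (G : sgraph) : Prop :=
  [/\ 0 < #|G|, connected G & acyclic G].

Definition anagram (C : eqType) (w : seq C) : Prop :=
  exists w1 w2 : seq C, [/\ w = w1 ++ w2, w1 <> [::] & perm_eq w1 w2].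

Definition anagram_free (G : sgraph) (C : eqType) (f : G -> C) : Prop :=
  forall p : seq G, is_path p -> ~ anagram (map f p).

Definition anagram_free_colourable (G : sgraph) (k : nat) : Prop :=
  exists f : G -> 'I_k, anagram_free f.

Lemma ex_anagram_free_colourable (G : sgraph) :
  exists k, `[< anagram_free_colourable G k >].
Proof.
exists #|G|; apply/asboolP; exists (@enum_rank G).
move=> p /andP[Up _] [w1 [w2 [pE w1N0 w12]]].
have: uniq (w1 ++ w2) by rewrite -pE map_inj_uniq //; exact: enum_rank_inj.
rewrite cat_uniq => /and3P[_ /hasPn w21 _].
case: w1 w1N0 {pE} w12 w21 => // a w1 _ w12 w21.
have aw2: a \in w2 by rewrite -(perm_mem w12) mem_head.
by move/negP: (w21 a aw2); apply; exact: mem_head.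
Qed.

Definition anagram_free_chromatic_number (G : sgraph) : nat :=
  ex_minn (ex_anagram_free_colourable G).

(* Main.v *)
Require Import Defs.
From mathcomp Require Import all_boot.
From mathcomp Require Import boolp zify.

(** Every colouring of a deep enough complete binary tree with [c] colours
    contains an anagram; the depth is found by induction on the number of
    colours that may occur.

    Suppose that depth [h] suffices for one colour fewer, and let [a] be a
    colour that occurs.  If some complete subtree of depth [h] avoids [a], the
    induction hypothesis applies to it.  Otherwise every vertex has a descendant
    of colour [a] at distance at most [h].  Starting from the root, move to such
    a descendant, then branch into both children, and repeat [k] times: this
    embeds a subdivided binary tree with [2 ^ k] leaves, all of whose branching
    vertices and leaves have colour [a] ([branch]).  The number of occurrences
    of each colour between a leaf and the root is at most linear in [k], so the
    leaves realise only polynomially many count vectors; for large [k], two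
    leaves [u] and [v] have the same one ([equal_counts]).  Let [w] be the vertex
    where their paths to the root meet.  The path from [u] up to but excluding
    [w] and the path from [v] up to but excluding [w] have the same colour
    counts.  Since [u] and [w] both have colour [a], [w] can replace [u] in the
    first one: the path from the parent of [u] through [w] down to [v] is
    an anagram ([anagram_through]). *)

(** * The infinite binary tree *)

(** Vertices are words whose head is the last turn taken from the root, so that
    the ancestors of a vertex are its suffixes. *)
Definition is_parent (t s : seq bool) : bool := (s != [::]) && (behead s == t).

Definition word_adj (s t : seq bool) : bool := is_parent t s || is_parent s t.

Lemma word_adj_sym : symmetric word_adj.
Proof. by move=> s t; rewrite /word_adj orbC. Qed.

Lemma word_adj_cons b s : word_adj (b :: s) s.
Proof. by rewrite /word_adj /is_parent /= eqxx. Qed.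

Lemma word_adj_irr : irreflexive word_adj.
Proof.
move=> s; rewrite /word_adj orbb /is_parent.
by case: s => //= b s; apply/eqP => /(congr1 size) /=; lia.
Qed.

Lemma word_adj_cat r s t : word_adj s t -> word_adj (s ++ r) (t ++ r).
Proof.
rewrite /word_adj; have H u v : is_parent u v -> is_parent (u ++ r) (v ++ r).
  by case: v => // b v; rewrite /is_parent /= => /eqP->.
by case/orP => /H ->; rewrite ?orbT.
Qed.

Lemma word_adj_le s t : word_adj s t -> size t <= size s -> t = behead s.
Proof.
rewrite /word_adj /is_parent => /orP[/andP[_ /eqP->]//|].
by case: t => //= b t /eqP->; lia.
Qed.

(** * Anagrams at a branching vertex *)

(** The upward path from [t ++ w] to [w], without [w]: ascents of two branches
    that meet at [w] are then disjoint. *)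
Fixpoint ascent (t w : seq bool) : seq (seq bool) :=
  if t is b :: t' then (t ++ w) :: ascent t' w else [::].

Lemma ascent_cat t1 t2 w : ascent (t1 ++ t2) w = ascent t1 (t2 ++ w) ++ ascent t2 w.
Proof. by elim: t1 => //= b t1 ->; rewrite catA. Qed.

Lemma size_ascent t w : size (ascent t w) = size t.
Proof. by elim: t => //= b t ->. Qed.

Lemma ascentP t w s : s \in ascent t w ->
  exists2 t', s = t' ++ w & 0 < size t' <= size t.
Proof.
elim: t => //= b t IH; rewrite inE => /orP[/eqP->|/IH[t' -> Ht']].
  by exists (b :: t) => //=; lia.
by exists t' => //; lia.
Qed.

Lemma ascent_branch t b w s : s \in ascent (rcons t b) w ->
  exists t', s = t' ++ b :: w.
Proof.
elim: t => [|b' t IH] /=; first by rewrite inE => /eqP->; exists [::].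
rewrite inE => /orP[/eqP->|//]; exists (b' :: t).
by rewrite cat_rcons.
Qed.

Lemma ascent_uniq t w : uniq (ascent t w).
Proof.
elim: t => //= b t ->; rewrite andbT; apply/negP.
move=> /ascentP[t' /(congr1 size)]; rewrite /= !size_cat; lia.
Qed.

Lemma ascent_path t w : sorted word_adj (rcons (ascent t w) w).
Proof.
elim: t => //= b t; case: t => [|b' t] /=; first by rewrite word_adj_cons.
by move=> ->; rewrite word_adj_cons.
Qed.

Lemma notin_ascent t w : w \notin ascent t w.
Proof.
apply/negP => /ascentP[t' /(congr1 (@size bool))].
rewrite size_cat; lia.
Qed.

Lemma cat_branch_inj u v b1 b2 (w : seq bool) :
  u ++ b1 :: w = v ++ b2 :: w -> b1 = b2.
Proof.
move=> E; have := congr1 (@size bool) E; rewrite !size_cat /= => sz.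
have {}sz : size u = size v by lia.
have /eqP := E; rewrite eqseq_cat; last exact: sz.
by case/andP=> _ /eqP[].
Qed.

(** If the upper end [w] has the same colour as the lower end of one of two
    branches with equal colour counts, then [w] takes the place of that lower
    end, and the path through [w] splits right after [w]. *)
Lemma anagram_through (C : eqType) (col : seq bool -> C) b t1 t2 w :
    let s1 := rcons t1 b in let s2 := rcons t2 (~~ b) in
    col (s1 ++ w) = col w ->
    perm_eq (map col (ascent s1 w)) (map col (ascent s2 w)) ->
  let p := behead (ascent s1 w) ++ w :: rev (ascent s2 w) in
  [/\ uniq p, sorted word_adj p & anagram (map col p)].
Proof.
move=> s1 s2 colw perm12 p.
have sub1 : {subset behead (ascent s1 w) <= ascent s1 w} by exact: mem_behead.
split.
- rewrite /p cat_uniq /= mem_rev notin_ascent rev_uniq ascent_uniq !andbT.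
  have -> /= : uniq (behead (ascent s1 w)).
    by have := ascent_uniq s1 w; case: (ascent s1 w) => //= ? ? /andP[].
  rewrite negb_or; apply/andP; split.
    by apply/negP => /sub1; apply/negP/notin_ascent.
  apply/hasPn => s; rewrite mem_rev => /ascent_branch[u ->].
  (* The two branches differ in the turn taken just below [w]. *)
  apply/negP => /sub1 /ascent_branch[v] /cat_branch_inj.
  by case: (b).
- rewrite /p sorted_cat_cons; apply/andP; split.
    by have := ascent_path s1 w; case: (ascent s1 w) => //= s q /path_sorted.
  have := ascent_path s2 w; rewrite -rev_sorted rev_rcons /=.
  rewrite (eq_path (e' := word_adj)) // => s t; exact: word_adj_sym.
- rewrite /p -cat_rcons map_cat map_rev.
  exists (map col (rcons (behead (ascent s1 w)) w)), (rev (map col (ascent s2 w))).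
  split=> //; first by case: (behead _).
  rewrite perm_sym perm_rev perm_sym; apply: perm_trans perm12.
  rewrite map_rcons perm_rcons -colw /s1.
  by case: (t1) => [|b' t] //=.
Qed.

(** * Finding two leaves with equal colour counts *)

(** A multiset of fewer than [M] colours is determined by its multiplicities,
    each of which takes at most [M] values. *)
Lemma equal_counts (I C : finType) (F : I -> seq C) M :
    (forall i, size (F i) < M) -> M ^ #|C| < #|I| ->
  exists2 ij : I * I, ij.1 != ij.2 & perm_eq (F ij.1) (F ij.2).
Proof.
case: M => [|M] szF.
  by move=> cardI; case: (pickP I) cardI => [i|/eq_card0->//]; have := szF i.
move=> cardI.
pose P i := [ffun a : C => inord (count_mem a (F i)) : 'I_M.+1].
have /injectivePn[i [j neq_ij eq_Pij]] : ~~ injectiveb P.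
  apply/negP => /injectiveP /leq_card.
  by rewrite card_ffun card_ord leqNgt cardI.
exists (i, j) => //; apply/allP => a _ /=; apply/eqP.
have := congr1 (fun f : {ffun C -> 'I_M.+1} => val (f a)) eq_Pij.
by rewrite /= !ffunE !inordK // (leq_ltn_trans (count_size _ _)) ?szF.
Qed.

Lemma diverging_words (x y : seq bool) : size x = size y -> x <> y ->
  exists b x' y' z, x = x' ++ b :: z /\ y = y' ++ ~~ b :: z.
Proof.
elim: x y => [|b1 x IH] [|b2 y] //= [eq_sz] neq_xy.
have [eq_xy|/eqP/(IH _ eq_sz)[b [x' [y' [z [-> ->]]]]]] := eqVneq x y; last first.
  by exists b, (b1 :: x'), (b2 :: y'), z.
exists b1, [::], [::], x; rewrite -eq_xy; split=> //=; congr (_ :: _).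
by case: b1 b2 neq_xy => [] [] // []; rewrite eq_xy.
Qed.

Lemma exists_poly_lt_exp h c : exists k, (k.+1 * h.+1) ^ c < 2 ^ k.
Proof.
(* With [k = 2 ^ m], the left-hand side is at most [2 ^ (c * (m + h + 2))], so
   [c * (m + h + 2) < 2 ^ m] suffices; [m = 2 * j] lets one factor [2 ^ j]
   dominate each of [c] and [m + h + 2]. *)
pose j := c + h + 4; pose m := j + j; exists (2 ^ m).
have lt_exp : 3 * j < 2 ^ j.
  rewrite /j addnC; elim: (c + h) => // n; rewrite addnS expnS; lia.
have lt_c : c < 2 ^ j by rewrite /j in lt_exp *; lia.
have le_exp : c * (m + h + 2) < 2 ^ m.
  by rewrite /m expnD ltn_mul //; rewrite /j in lt_exp *; lia.
apply: leq_ltn_trans (_ : 2 ^ (c * (m + h + 2)) < _); last by rewrite ltn_exp2l.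
rewrite [c * _]mulnC expnM.
have le_base : (2 ^ m).+1 * h.+1 <= 2 ^ (m + h + 2).
  have -> : m + h + 2 = m.+1 + h.+1 by lia.
  rewrite expnD leq_mul //; last exact/ltnW/ltn_expl.
  have := expn_gt0 2 m; rewrite expnS; lia.
by case: (c) => // c'; rewrite leq_exp2r.
Qed.

(** * Monochromatic branching *)

(** [branch g] embeds the binary tree into itself, with an edge subdivided into
    a path: after each turn, [g] chooses how to go on down to the next branching
    vertex. *)
Fixpoint branch (g : seq bool -> seq bool) (x : seq bool) : seq bool :=
  if x is b :: y then let s := b :: branch g y in g s ++ s else g [::].

Lemma branch_cat g x b z : exists t, branch g (x ++ b :: z) = t ++ b :: branch g z.
Proof.
elim: x => [|b' x [t IH]] /=; first by exists (g (b :: branch g z)).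
by rewrite IH; eexists (_ ++ b' :: t); rewrite -catA.
Qed.

(** The bound [c] on all the colours stays fixed in the induction on the number
    [n] of colours that occur, so that [D] depends on [c] and [n] only. *)
Lemma anagram_in_deep_tree c n : exists D,
  forall (C : finType) (S : {set C}) (col : seq bool -> C),
    #|C| <= c -> #|S| <= n -> (forall s, size s <= D -> col s \in S) ->
  exists p : seq (seq bool),
    [/\ uniq p, sorted word_adj p, all (fun s : seq bool => size s <= D) p
      & anagram (map col p)].
Proof.
elim: n => [|n [h IH]].
  exists 0 => C S col _; rewrite leqn0 cards_eq0 => /eqP-> /(_ [::] isT).
  by rewrite inE.
have [k lt_k] := exists_poly_lt_exp h c; pose D := k * h.+1 + h.
exists D => C S col cardC cardS colS.
pose a := col [::].
(* Either some subtree of depth [h] avoids [a], or [a] is always within reach. *)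
have [[s sz_s avoid]|reach] := pselect (exists2 s, size s <= k * h.+1 &
    forall t, size t <= h -> col (t ++ s) != a).
  have [|t sz_t|p [Up Pp Dp Ap]] := IH C (S :\ a) (fun t => col (t ++ s)) cardC.
  - by have := cardsD1 a S; rewrite colS //= => E; lia.
  - by rewrite !inE avoid // colS // size_cat /D; lia.
  exists (map (cat^~ s) p); split.
  - rewrite map_inj_uniq // => t1 t2 /(congr1 rev)/eqP.
    by rewrite !rev_cat eqseq_cat // eqxx => /eqP/(can_inj revK).
  - by rewrite sorted_map; apply: sub_sorted Pp => ? ?; apply: word_adj_cat.
  - rewrite all_map; apply: sub_all Dp => t /=; rewrite size_cat /D; lia.
  - by rewrite -map_comp.
have /choice[g gP] s :
    exists t, size s <= k * h.+1 -> size t <= h /\ col (t ++ s) = a.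
  have [sz_s|] := boolP (size s <= k * h.+1); last by exists [::].
  apply: contrapT => no_t; apply: reach; exists s => // t sz_t.
  by apply/eqP => colt; apply: no_t; exists t.
pose L := branch g.
(* At most [h] steps precede the first turn and follow each turn. *)
have LP x : size x <= k -> size (L x) <= size x * h.+1 + h /\ col (L x) = a.
  elim: x => [_|b x IHx sz_x]; first by have [] := gP [::] isT; rewrite cats0.
  have [sz_L _] := IHx (ltnW sz_x).
  have le_k : size x * h.+1 + h.+1 <= k * h.+1.
    by rewrite addnC -mulSn leq_mul2r sz_x orbT.
  have [|szg colg] := gP (b :: L x); first by move=> /=; lia.
  have -> : L (b :: x) = g (b :: L x) ++ b :: L x by [].
  split=> //; rewrite size_cat -[size (b :: x)]/(size x).+1 mulSn.
  rewrite -[size (b :: L x)]/(size (L x)).+1; lia.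
pose F (x : k.-tuple bool) := map col (ascent (L x) [::]).
have [x||[x y] /= neq_xy permF] := @equal_counts _ _ F (k.+1 * h.+1).
- rewrite size_map size_ascent.
  have [|szx _] := LP x; first by rewrite size_tuple.
  by rewrite size_tuple in szx; apply: leq_ltn_trans szx _; rewrite mulSn; lia.
- apply: leq_ltn_trans (_ : _ <= (k.+1 * h.+1) ^ c) _; first by rewrite leq_pexp2l.
  by rewrite card_tuple card_bool.
have [|/eqP|b [x' [y' [z [xE yE]]]]] := @diverging_words x y.
- by rewrite !size_tuple.
- by rewrite val_eqE (negPf neq_xy).
have sz_z : size z <= k by rewrite -(size_tuple x) xE size_cat /=; lia.
have [t1 Lx] := branch_cat g x' b z; have [t2 Ly] := branch_cat g y' (~~ b) z.
rewrite -xE -/L -cat_rcons in Lx; rewrite -yE -/L -cat_rcons in Ly.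
have [|szx colx] := LP x; first by rewrite size_tuple.
have [|szy coly] := LP y; first by rewrite size_tuple.
(* The two paths to the root meet at [L z], and share its path to the root. *)
have [_ colz] := LP z sz_z.
have [||Up Pp Ap] := @anagram_through _ col b t1 t2 (L z).
- by rewrite -Lx colx colz.
- move: permF; rewrite /F Lx Ly !ascent_cat !cats0 !map_cat.
  by rewrite perm_cat2r.
eexists; split; [exact: Up | exact: Pp | | exact: Ap].
rewrite size_tuple Lx size_cat in szx; rewrite size_tuple Ly size_cat in szy.
apply/allP => s; rewrite mem_cat inE mem_rev => /or3P[/mem_behead||].
- by case/ascentP=> t -> /andP[_ szt]; rewrite size_cat /D; lia.
- by move/eqP->; rewrite /D; lia.
- by case/ascentP=> t -> /andP[_ szt]; rewrite size_cat /D; lia.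
Qed.

(** * The finite binary tree *)

Definition tree_adj (D : nat) : rel (D.-bseq bool) := relpre val word_adj.

Lemma tree_adj_sym D : symmetric (@tree_adj D).
Proof. by move=> s t; apply: word_adj_sym. Qed.

Lemma tree_adj_irr D : irreflexive (@tree_adj D).
Proof. by move=> s; apply: word_adj_irr. Qed.

Definition binary_tree (D : nat) : sgraph :=
  SGraph (@tree_adj_sym D) (@tree_adj_irr D).

(** In a cycle, the two neighbours of a vertex of maximal depth would both be
    its parent. *)
Lemma binary_tree_is_tree D : is_tree (binary_tree D).
Proof.
split.
- by apply/card_gt0P; exists ([bseq] : D.-bseq bool).
- suff root s : connect (@adj (binary_tree D)) s ([bseq] : D.-bseq bool).
    move=> s t; apply: connect_trans (root s) _.
    by rewrite (sym_connect_sym (@tree_adj_sym D)).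
  case: s => s; elim: s => [|b s IH] sz_s.
    by rewrite (_ : Bseq _ = [bseq]) //; apply: val_inj.
  apply: connect_trans (IH (ltnW sz_s)); apply: connect1; exact: word_adj_cons.
- move=> p sz_p cyc_p.
  have /hasP[x0 x0p _] : has predT p by rewrite has_predT; lia.
  have [/= x xp max_x] := arg_maxnP (fun s : D.-bseq bool => size s) x0p.
  have [i q pE] := rot_to xp.
  have : ucycle (@adj (binary_tree D)) (x :: q) by rewrite -pE rot_ucycle.
  have {}max_x y : y \in x :: q -> size y <= size x.
    by rewrite -pE mem_rot; apply: max_x.
  have : 2 < size (x :: q) by rewrite -pE size_rot.
  case: q {pE} max_x => // y q; case/lastP: q => // q z max_x _.
  case/andP=> /=; rewrite !rcons_path last_rcons.
  case/andP=> xy /andP[_ zx] /and3P[_].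
  rewrite mem_rcons inE negb_or => /andP[/eqP neq_yz _] _.
  apply: neq_yz; apply: val_inj.
  rewrite (word_adj_le _ _ xy); last by apply: max_x; rewrite !inE eqxx orbT.
  rewrite /= (word_adj_le (val x) (val z)) //; first by rewrite word_adj_sym.
  by apply: max_x; rewrite !inE mem_rcons inE eqxx !orbT.
Qed.

Theorem theorem3 (c : nat) (c_gt0 : 0 < c) :
  exists T : sgraph, is_tree T /\ c < anagram_free_chromatic_number T.
Proof.
have [D anagramD] := anagram_in_deep_tree c c.
exists (binary_tree D); split; first exact: binary_tree_is_tree.
rewrite /anagram_free_chromatic_number; case: ex_minnP => m /asboolP[f free_f] _.
rewrite ltnNge; apply/negP => le_mc.
pose vertex_of s : binary_tree D := insub_bseq D s.
have [|||p [Up Pp Dp Ap]] := anagramD _ [set: 'I_m] (f \o vertex_of).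
- by rewrite card_ord.
- by rewrite cardsT card_ord.
- by move=> s _; rewrite inE.
have valK : map val (map vertex_of p) = p.
  rewrite -map_comp; apply: map_id_in => s /(allP Dp) sz_s.
  by rewrite /= /vertex_of /insub_bseq val_insubd sz_s.
apply: (free_f (map vertex_of p)); last by rewrite -map_comp.
by rewrite /is_path -(map_inj_uniq val_inj) valK Up -sorted_map valK.
Qed.
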